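(* For every infinite word $w$ over a finite alphabet and for every integer $n\geq 6$, $$L_w(n)+L_w(n+1)+L_w(n+2) \leq C_w(n)-C_w(n-1)+1+3|\mathrm{Alph}(w)|+|\mathrm{Alph}(w)|^2+p(n+1)+p(n+2),$$ where $L_w(k)$ is the value of the Lie complexity function of $w$ at $k$, $C_w(k)$ is the number of length-$k$ factors of $w$, $|\mathrm{Alph}(w)|$ is the cardinality of the alphabet of $w$, and $p(k)$ is the cardinality of the set $\{[u] : [u]\subset \mathrm{Fac}(w),\ |u|=k,\ u \text{ is primitive}\}$.
   Context: A factor of $w$ is a finite block of contiguous letters of $w$ (the empty word included). $\mathrm{Fac}(w)$ is the set of all factors of $w$. $\mathrm{Alph}(w)$ is the set of letters occurring in $w$. Two finite words $u,v$ are conjugate if $u=xy$ and $v=yx$ for some words $x,y$; $[u]$ denotes the conjugacy class of $u$. A finite word is primitive if it is not a power $v^k$ ($k$ a natural number) of another word $v$. The Lie complexity function is defined, for positive $n$, by $L_w(n)=|\{[u] : [u]\subset\mathrm{Fac}(w),\ |u|=n\}|$, the number of conjugacy classes of length-$n$ words all of whose elements are factors of $w$. *)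

(* Defs.v *)
From mathcomp Require Import all_boot all_order all_algebra.
From mathcomp Require Import boolp.

Set Implicit Arguments.
Unset Strict Implicit.
Unset Printing Implicit Defensive.

(* An infinite word over the alphabet A is a map w : nat -> A, and finite words
   are elements of seq A. *)

Definition Fac (A : Type) (w : nat -> A) (u : seq A) : Prop :=
  exists i : nat, u = [seq w j | j <- iota i (size u)].

Definition Alph (A : finType) (w : nat -> A) : {set A} :=
  [set a | `[< exists i : nat, w i = a >]].

Definition conjugate (A : Type) (u v : seq A) : Prop :=
  exists x y : seq A, u = x ++ y /\ v = y ++ x.

Definition word_pow (A : Type) (v : seq A) (k : nat) : seq A :=
  flatten (nseq k v).

Definition primitive (A : Type) (u : seq A) : Prop :=
  ~ exists (v : seq A) (k : nat), v <> u /\ u = word_pow v k.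

Definition Fac_len (A : finType) (w : nat -> A) (n : nat) :
  {set n.-tuple A} := [set u : n.-tuple A | `[< Fac w u >]].

(* Conjugate words have the same length, so the conjugacy class of a word of
   length n can be taken inside n.-tuple A. *)
Definition conj_class (A : finType) (n : nat) (u : n.-tuple A) :
  {set n.-tuple A} := [set v : n.-tuple A | `[< conjugate u v >]].

Definition factor_complexity (A : finType) (w : nat -> A) (n : nat) : nat :=
  #|Fac_len w n|.

Definition lie_complexity (A : finType) (w : nat -> A) (n : nat) : nat :=
  #|[set conj_class u | u : n.-tuple A & conj_class u \subset Fac_len w n]|.

Definition primitive_lie_complexity (A : finType) (w : nat -> A) (n : nat) :
  nat :=
  #|[set conj_class u | u : n.-tuple A
      & (conj_class u \subset Fac_len w n) && `[< primitive u >]]|.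

(* Main.v *)
Require Import Defs.
From mathcomp Require Import all_boot all_order all_algebra.
From mathcomp Require Import boolp zify.

Set Implicit Arguments.
Unset Strict Implicit.
Unset Printing Implicit Defensive.

(** Consider the Rauzy graph of [w] whose vertices are the factors of length
    [n - 1] and whose edges are the factors of length [n], an edge going from
    its prefix to its suffix of length [n - 1]. Reading [w] from left to right
    is a walk through the whole graph, so the graph is connected, and
    [C(n) - C(n-1) + 1] is the dimension of its cycle space. It therefore
    suffices to exhibit enough independent cycles.

    A conjugacy class of words of length [m >= n] that consists of factors of
    [w] yields a closed walk: its edges are the windows of length [n] of the
    periodic word [x x x ...], for any [x] in the class. Since [L - p] counts
    the classes of non-primitive words, the claim is about the cycles given by
    all classes of length [n] and by the non-primitive classes of lengths
    [n + 1] and [n + 2]. A cycle can occur twice in that list only if its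
    period is 1 or 2: discarding the constant classes at length [n + 1] and
    those of period 2 at length [n + 2] costs at most
    [|Alph(w)| + |Alph(w)|^2], which the right-hand side can afford.

    The remaining cycles are independent, for two reasons based on the theorem
    of Fine and Wilf:
    - two cycles of non-primitive classes that share an edge agree on [n]
      letters; their periods are proper divisors of numbers at most [n + 2],
      hence short enough for the two periodic words to coincide
      ([repetitive_agree]);
    - the cycle of a primitive class of length [n] has an edge outside all
      cycles of the non-primitive classes of lengths [n + 1] and [n + 2].
      Otherwise every rotation of the word has a short period; consecutive
      rotations overlap in [n - 1] letters, so a single period [d] works for
      all of them, and the word has cyclic period [gcd(n, d)], which is at
      most 2, against primitivity ([private_window]).

    Independence is used in the following form ([joins_cycles]): one edge per
    cycle can be removed without disconnecting the graph, and a connected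
    graph on [V] vertices has at least [V - 1] edges. *)

(** * Periods of words *)

Definition local_period (A : Type) (d n : nat) (h : nat -> A) : Prop :=
  forall i, i + d < n -> h (i + d) = h i.

Definition periodic (A : Type) (d : nat) (P : nat -> A) : Prop :=
  forall i, P (i + d) = P i.

Lemma local_period_mod (A : Type) d n (h : nat -> A) :
  local_period d n h -> forall i, i < n -> h i = h (i %% d).
Proof.
move=> per i; rewrite {1 2}(divn_eq i d); elim: (i %/ d) => [|k IH] lt_n //.
rewrite mulSn [d + _]addnC -addnA [d + _]addnC addnA in lt_n *.
by rewrite per // IH //; lia.
Qed.

(** Euclid's algorithm on the two periods: on the prefix of length [n - p], the
    word also has period [q - p]; the last [p] letters follow by the period
    [p]. Stating the conclusion through remainders makes this extension a
    single shift by [p]. *)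
Lemma fine_wilf (A : Type) p q n (h : nat -> A) :
    0 < p -> 0 < q -> p + q <= n + gcdn p q ->
    local_period p n h -> local_period q n h ->
  forall i, i < n -> h i = h (i %% gcdn p q).
Proof.
have [N] := ubnP (p + q); elim: N => // N IH in p q n *.
wlog le_pq : p q / p <= q => [WL|].
  case/orP: (leq_total p q) => le_pq; first exact: WL.
  by move=> ltN p0 q0 len perp perq; rewrite gcdnC; apply: WL => //;
    rewrite 1?addnC 1?gcdnC.
move=> ltN p0 q0 len perp perq i lt_in.
have [eq_pq|ne_pq] := eqVneq p q.
  by rewrite -eq_pq gcdnn; exact: local_period_mod perp _ _.
have lt_pq : p < q by lia.
have gE : gcdn p q = gcdn p (q - p).
  by rewrite -{1}(subnKC le_pq) gcdnDl.
have g_dvd : gcdn p q %| q - p by rewrite gE dvdn_gcdr.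
have g_le : gcdn p q <= q - p by apply: dvdn_leq => //; lia.
have IHp j : j < n - p -> h j = h (j %% gcdn p q).
  rewrite gE; apply: (IH p (q - p) (n - p)) => //; try lia.
  - by move=> k lt_k; apply: perp; lia.
  - move=> k lt_k; rewrite -[RHS]perq; last by lia.
    by rewrite -perp; [congr h; lia | lia].
have [/IHp //|ge_i] := ltnP i (n - p).
have le_pi : p <= i by lia.
have {1}-> : i = (i - p) + p by lia.
rewrite perp; last by lia.
rewrite IHp; last by lia.
congr h; rewrite -[in RHS](subnK le_pi).
by rewrite -modnDmr (eqP (dvdn_gcdl p q)) addn0.
Qed.

Lemma periodic_mul (A : Type) d (P : nat -> A) :
  periodic d P -> forall k, periodic (k * d) P.
Proof.
by move=> per; elim=> [|k IH] i; rewrite ?addn0 // mulSn addnCA addnC per IH.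
Qed.

Lemma periodic_dvd (A : Type) d e (P : nat -> A) :
  d %| e -> periodic d P -> periodic e P.
Proof. by case/dvdnP=> k -> /periodic_mul. Qed.

Lemma periodic_mod (A : Type) d (P : nat -> A) :
  periodic d P -> forall r i, P (r + i %% d) = P (r + i).
Proof.
move=> per r i; rewrite {2}(divn_eq i d) [_ * d + _]addnC addnA.
by rewrite periodic_mul.
Qed.

Lemma periodic_gcd (A : Type) p q (P : nat -> A) :
  periodic p P -> periodic q P -> periodic (gcdn p q) P.
Proof.
case: p => [|p] perp perq i; first by rewrite gcd0n.
have [u v uvE _] := egcdnP q (ltn0Sn p).
by rewrite -(periodic_mul perq v) -addnA [_ + v * q]addnC -uvE periodic_mul.
Qed.

Lemma local_of_periodic (A : Type) d n (P : nat -> A) :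
  periodic d P -> local_period d n P.
Proof. by move=> per i _. Qed.

(** * Finite windows of infinite words and conjugacy classes *)

Definition window (A : Type) (n : nat) (P : nat -> A) (r : nat) : n.-tuple A :=
  [tuple P (r + i) | i < n].

(** The infinite word [x x x ...]; the default letter [a] is only reached when
    [x] is empty. *)
Definition cyclic (A : Type) (a : A) (x : seq A) : nat -> A :=
  fun i => nth a x (i %% size x).

(** For [P] the infinite repetition of a word [x] of length [m], this says that
    [x] is a proper power, with root of length [d]. *)
Definition repetitive (A : Type) (m : nat) (P : nat -> A) : Prop :=
  exists d, [/\ d %| m, d < m & periodic d P].

Lemma nth_window (A : Type) (a : A) n P r i :
  i < n -> nth a (window n P r) i = P (r + i).
Proof.
by move=> lt_in; rewrite -[i]/(val (Ordinal lt_in)) -tnth_nth tnth_mktuple.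
Qed.

Lemma window_eq (A : Type) n (P Q : nat -> A) r s :
  window n P r = window n Q s <-> (forall i, i < n -> P (r + i) = Q (s + i)).
Proof.
split=> [eqw i lt_in | eqPQ].
  by rewrite -!(@nth_window _ (P 0) n _ _ _ lt_in) eqw.
by apply: eq_from_tnth => i; rewrite !tnth_mktuple; apply: eqPQ.
Qed.

Lemma cyclic_periodic (A : Type) (a : A) m (x : m.-tuple A) :
  periodic m (cyclic a x).
Proof. by move=> i; rewrite /cyclic size_tuple modnDr. Qed.

Lemma cyclic_window (A : Type) (a : A) m P r i :
  0 < m -> periodic m P -> cyclic a (window m P r) i = P (r + i).
Proof.
move=> m0 per; rewrite /cyclic size_tuple nth_window ?ltn_pmod //.
exact: periodic_mod.
Qed.

Lemma window_cyclic (A : Type) (a : A) m (x : m.-tuple A) :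
  window m (cyclic a x) 0 = x.
Proof.
apply: eq_from_tnth => i; rewrite tnth_mktuple /cyclic size_tuple.
by rewrite add0n modn_small // (tnth_nth a).
Qed.

Lemma FacP (A : finType) (w : nat -> A) n (u : n.-tuple A) :
  u \in Fac_len w n <-> exists i, u = window n w i.
Proof.
rewrite inE asboolE /Fac size_tuple; split=> -[i uE]; exists i.
  apply: eq_from_tnth => j; rewrite tnth_mktuple (tnth_nth (w 0)) uE.
  by rewrite (nth_map 0) ?size_iota // nth_iota.
apply: (@eq_from_nth _ (w 0)); rewrite ?size_map ?size_iota ?size_tuple //.
by move=> j lt_jn; rewrite uE nth_window // (nth_map 0) ?size_iota // nth_iota.
Qed.

(** A conjugate of [x] is what one reads on the infinite word [x x x ...]
    through a window of length [m]; this replaces factorizations of words by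
    arithmetic on positions. *)
Lemma conj_classP (A : finType) (a : A) m (x v : m.-tuple A) :
  0 < m -> v \in conj_class x <-> exists r, v = window m (cyclic a x) r.
Proof.
move=> m0; rewrite inE asboolE; split=> [[y [z [xE vE]]]|[r vE]].
  have m_yz : size y + size z = m by rewrite -(size_tuple x) xE size_cat.
  exists (size y); apply: eq_from_tnth => i; have lt_im := ltn_ord i.
  rewrite tnth_mktuple (tnth_nth a) /cyclic size_tuple vE xE !nth_cat.
  have [lt_iz|ge_iz] := ltnP i (size z).
    by rewrite modn_small ?ltnNge ?leq_addr /= ?addKn //; lia.
  have -> : size y + i = i - size z + m by lia.
  by rewrite modnDr modn_small; [case: ltnP => //; lia | lia].
have lt_rm : r %% m < m by rewrite ltn_pmod.
exists (take (r %% m) x), (drop (r %% m) x); rewrite cat_take_drop; split=> //.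
rewrite -[LHS]/(val v); apply: (@eq_from_nth _ a).
  by rewrite size_cat size_drop size_take_min !size_tuple; lia.
move=> i; rewrite size_tuple => lt_im; rewrite vE nth_window // nth_cat.
rewrite size_drop size_tuple nth_drop /cyclic size_tuple -modnDml.
case: ltnP => cmp; first by rewrite modn_small //; lia.
have -> : r %% m + i = (i - (m - r %% m)) + m by lia.
by rewrite modnDr modn_small ?nth_take //; lia.
Qed.

Lemma conj_class_eq (A : finType) (a : A) m (x y : m.-tuple A) r s :
  0 < m -> (forall i, cyclic a x (r + i) = cyclic a y (s + i)) ->
  conj_class x = conj_class y.
Proof.
move=> m0.
wlog suff: x y r s /
    (forall i, cyclic a x (r + i) = cyclic a y (s + i)) ->
    conj_class x \subset conj_class y.
  by move=> WL exy; apply/eqP; rewrite eqEsubset (WL x y r s) ?(WL y x s r).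
move=> exy; apply/subsetP => v /(conj_classP a _ _ m0) [t ->].
(* r * m - r plays the role of the shift by - r, modulo the period m. *)
apply/(conj_classP a _ _ m0); exists (s + (r * m - r) + t).
apply/window_eq => i _; rewrite -!addnA -exy.
rewrite -[LHS](periodic_mul (cyclic_periodic a x) r); congr (cyclic a x _).
have : r <= r * m by rewrite leq_pmulr.
by lia.
Qed.

(** * Overlaps of repetitive words *)

(** A period of a tail is a period of the whole word, because a periodic word
    recurs within each of its tails. *)
Lemma periodic_shift (A : Type) d m (P : nat -> A) r :
  0 < m -> periodic m P -> periodic d (fun i => P (r + i)) -> periodic d P.
Proof.
move=> m0 perm perd i.
have le_r : r <= r * m by rewrite leq_pmulr.
rewrite -(periodic_mul perm r i) -(periodic_mul perm r (i + d)).
have -> : i + d + r * m = r + (i + (r * m - r) + d) by lia.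
by rewrite perd; congr P; lia.
Qed.

Lemma periodic_shift_eq (A : Type) d m (P Q : nat -> A) r s :
  0 < m -> periodic m P -> periodic d Q -> (forall i, P (r + i) = Q (s + i)) ->
  periodic d P.
Proof.
move=> m0 perm perd eqPQ; apply: (periodic_shift (r := r) m0 perm) => i.
by rewrite !eqPQ addnA perd.
Qed.

Lemma proper_dvd_pos m d :
  d %| m -> d < m -> 0 < d.
Proof. by case: d => // /[!dvd0n] /eqP ->. Qed.

(** If one of the periods is at most a third of its length, their sum is at most
    [(n + 2) / 2 + (n + 2) / 3]; if both are halves and differ, then so do [m]
    and [m']. In both cases the sum is at most [n + 1], and the gcd is at least
    1. Equal periods are their own gcd. *)
Lemma periods_bound n m m' d d' :
  4 <= n -> n <= m <= n + 2 -> n <= m' <= n + 2 ->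
  d %| m -> d < m -> d' %| m' -> d' < m' -> d + d' <= n + gcdn d d'.
Proof.
move=> n4 mb mb' dm ltdm dm' ltdm'.
have d0 := proper_dvd_pos dm ltdm; have d0' := proper_dvd_pos dm' ltdm'.
have g0 : 0 < gcdn d d' by rewrite gcdn_gt0 d0.
move: dm dm' => /dvdnP[k kE] /dvdnP[k' kE'].
have k2 : 2 <= k by case: k kE => [|[|k]] //; lia.
have k2' : 2 <= k' by case: k' kE' => [|[|k']] //; lia.
have [eqd|ned] := eqVneq d d'; first by rewrite eqd gcdnn; nia.
have : 3 <= k \/ 3 <= k' \/ (k = 2 /\ k' = 2) by lia.
by case=> [?|[?|[? ?]]]; subst; nia.
Qed.

(** The window of length [n] has the periods of both words, and is long enough
    for the theorem of Fine and Wilf. It then has period [gcd(d, d')], and it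
    contains a full period of each word, so it determines both. *)
Lemma repetitive_agree (A : Type) n m m' (P Q : nat -> A) r s :
    4 <= n -> n <= m <= n + 2 -> n <= m' <= n + 2 ->
    repetitive m P -> repetitive m' Q ->
    (forall i, i < n -> P (r + i) = Q (s + i)) ->
  forall i, P (r + i) = Q (s + i).
Proof.
move=> n4 mb mb' [d [dm ltdm perd]] [d' [dm' ltdm' perd']] eqPQ.
have d0 := proper_dvd_pos dm ltdm; have d0' := proper_dvd_pos dm' ltdm'.
have bound := periods_bound n4 mb mb' dm ltdm dm' ltdm'.
pose h i := P (r + i); pose h' i := Q (s + i).
have perh : periodic d h by move=> i; rewrite /h addnA perd.
have perh' : periodic d' h' by move=> i; rewrite /h' addnA perd'.
have perh1 : local_period d' n h.
  by move=> i lt_i; rewrite /h !eqPQ //; [exact: perh' | lia].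
have red := fine_wilf d0 d0' bound (local_of_periodic perh) perh1.
have le_dn : d <= n.
  case/dvdnP: (dm) => [[|[|k]]] E; nia.
have le_dn' : d' <= n.
  case/dvdnP: (dm') => [[|[|k]]] E; nia.
move=> i; rewrite -[LHS]/(h (0 + i)) -[RHS]/(h' (0 + i)).
rewrite -(periodic_mod perh) -(periodic_mod perh') !add0n.
have lt1 : i %% d < n by apply: leq_trans le_dn; rewrite ltn_pmod.
have lt2 : i %% d' < n by apply: leq_trans le_dn'; rewrite ltn_pmod.
rewrite red // [RHS](_ : _ = h (i %% d')); last by rewrite /h eqPQ.
by rewrite [RHS]red // !modn_dvdm ?dvdn_gcdl ?dvdn_gcdr.
Qed.

(** Two distinct periods cannot both be the half of [m] and of [m'], two
    integers among [n + 1] and [n + 2], so that their sum is at most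
    [(n + 2) / 2 + (n + 2) / 3]. This is at most [n] as soon as [n >= 10]; the
    smaller values of [n], where the gcd matters, are checked one by one. The
    bound fails for [n = 4], with periods 2 and 3 of words of length 6. *)
Lemma periods_bound_strict n m m' d d' :
  6 <= n -> n < m <= n + 2 -> n < m' <= n + 2 ->
  d %| m -> d < m -> d' %| m' -> d' < m' -> d <> d' ->
  d + d' <= n.-1 + gcdn d d'.
Proof.
move=> n6 mb mb' dm ltdm dm' ltdm' ned.
have d0 := proper_dvd_pos dm ltdm; have d0' := proper_dvd_pos dm' ltdm'.
have g0 : 0 < gcdn d d' by rewrite gcdn_gt0 d0.
have [n10|n10] := leqP 10 n.
  move: dm dm' => /dvdnP[k kE] /dvdnP[k' kE'].
  have k2 : 2 <= k by case: k kE => [|[|k]] //; lia.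
  have k2' : 2 <= k' by case: k' kE' => [|[|k']] //; lia.
  have : 3 <= k \/ 3 <= k' \/ (k = 2 /\ k' = 2) by lia.
  by case=> [?|[?|[? ?]]]; subst; nia.
pose ok n m m' d d' :=
  [&& n < m <= n + 2, n < m' <= n + 2, d %| m, d < m, d' %| m', d' < m'
    & d != d'] ==> (d + d' <= n.-1 + gcdn d d').
pose upto f := all f (iota 0 12).
have : all (fun n => upto (fun m => upto (fun m' => upto (fun d => upto (fun d' =>
  ok n m m' d d'))))) (iota 6 4) by vm_compute.
move=> /allP /(_ n) /[!mem_iota] /(_ ltac:(lia)).
move=> /allP /(_ m) /[!mem_iota] /(_ ltac:(lia)).
move=> /allP /(_ m') /[!mem_iota] /(_ ltac:(lia)).
move=> /allP /(_ d) /[!mem_iota] /(_ ltac:(lia)).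
move=> /allP /(_ d') /[!mem_iota] /(_ ltac:(lia)) /implyP; apply.
by rewrite mb mb' dm ltdm dm' ltdm'; apply/eqP.
Qed.

(** The rotations of the word starting at [r] and at [r + 1] share [n - 1]
    letters. If the first has period [d] and the second [d'], then the theorem
    of Fine and Wilf gives the common part the period [gcd(d, d')], which
    extends to the last letter of the second rotation by its period [d'].
    Hence [d] passes from each rotation to the next, and becomes a period of
    the infinite word. *)
Lemma private_window (A : Type) n (P : nat -> A) :
    6 <= n -> periodic n P -> ~ repetitive n P ->
  exists r, forall m (Q : nat -> A) s, n < m <= n + 2 -> repetitive m Q ->
    window n P r <> window n Q s.
Proof.
move=> n6 pern; apply: contra_notP => /forallNP noprivate.
have wper r : exists m d, [/\ n < m <= n + 2, d %| m, d < m &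
    local_period d n (fun i => P (r + i))].
  have /existsNP[m /existsNP[Q /existsNP[s]]] := noprivate r.
  move=> /not_implyP[mb /not_implyP[[d [dm ltdm perd]] /contrapT /window_eq eqPQ]].
  exists m, d; split=> // i lt_i; rewrite !eqPQ //; last by lia.
  by rewrite addnA perd.
have half m d : n < m <= n + 2 -> d %| m -> d < m -> 0 < d <= n.-1.
  move=> mb dm ltdm; rewrite (proper_dvd_pos dm ltdm) /=.
  by case/dvdnP: dm => [[|[|k]]] E; nia.
have [m [d [mb dm ltdm per0]]] := wper 0.
have /andP[d0 le_d] := half m d mb dm ltdm.
have wperd r : local_period d n (fun i => P (r + i)).
  elim: r => // r IH.
  have [m' [d' [mb' dm' ltdm' per']]] := wper r.+1.
  have /andP[d0' le_d'] := half m' d' mb' dm' ltdm'.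
  have [<-|ned] := pselect (d' = d); first exact: per'.
  have perd : local_period d n.-1 (fun i => P (r.+1 + i)).
    by move=> i lt_i; rewrite !addSnnS -addSn; apply: (IH i.+1); lia.
  have perd' : local_period d' n.-1 (fun i => P (r.+1 + i)).
    by move=> i lt_i; apply: per'; lia.
  have bound : d + d' <= n.-1 + gcdn d d'.
    by apply: (periods_bound_strict n6 mb mb') => // eqd; apply: ned.
  have red := fine_wilf d0 d0' bound perd perd'.
  move=> i lt_i; have [lt_i'|ge_i] := ltnP (i + d) n.-1; first exact: perd.
  (* Only the last letter, at position i + d = n - 1, is left: step back by d'
     into the common part, where residues modulo gcd(d, d') decide. *)
  rewrite (_ : i + d = (i + d - d') + d'); last by lia.
  rewrite per'; last by lia.
  rewrite red; last by lia.
  rewrite [RHS]red; last by lia.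
  congr (P (_ + _)); apply/eqP.
  rewrite -(eqn_modDr d') subnK; last by lia.
  by rewrite -[X in _ == X]modnDmr (eqP (dvdn_gcdr d d')) addn0
    -modnDmr (eqP (dvdn_gcdl d d')) addn0.
have perd : periodic d P.
  by move=> i; rewrite (wperd i 0) ?addn0 //; lia.
exists (gcdn n d); split; [exact: dvdn_gcdl | | exact: periodic_gcd].
have [k mE k12] : exists2 k, m = n + k & 0 < k <= 2 by exists (m - n); lia.
(* gcd(n, d) divides n and n + k, hence k <= 2, and so is smaller than n. *)
have : gcdn n d %| k.
  by rewrite -(dvdn_addr k (dvdn_gcdl n d)) -mE (dvdn_trans (dvdn_gcdr n d)).
by move=> /dvdn_leq; lia.
Qed.

(** * Removing one edge per cycle of a connected graph *)

(** In this part a directed multigraph has edges in [I] and vertices in [T],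
    with end points given by [s] and [t]; directions do not matter for
    connectivity. *)
Definition closed_under (T I : finType) (s t : I -> T) (H : {set I})
    (S : {set T}) : Prop :=
  forall e, e \in H -> (s e \in S) = (t e \in S).

(** Connectivity of [V] through the edges of [H], stated by cuts: a union of
    components contains all of [V] or misses it. This form avoids paths. *)
Definition joins (T I : finType) (s t : I -> T) (H : {set I})
    (V : {set T}) : Prop :=
  forall S, closed_under s t H S ->
  forall x y, x \in V -> y \in V -> (x \in S) = (y \in S).

(** A tree grown greedily: as long as [S] does not contain [V], some edge of
    [H] leaves [S]; adding it to [K] adds at most one vertex to [S]. *)
Lemma joins_card_grow (T I : finType) (s t : I -> T) (H K : {set I})
    (V S : {set T}) x :
    joins s t H V -> x \in V -> x \in S -> K \subset H ->
    {in K, forall e, (s e \in S) && (t e \in S)} ->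
  #|S| <= #|K|.+1 -> #|V| <= #|H|.+1.
Proof.
move=> joinsHV xV; have [k] := ubnP #|H :\: K|.
elim: k => // k IH in S K * => ltHK xS sKH inS leSK.
have [clS|/existsNP [e /not_implyP [eH neq]]] :=
  pselect (closed_under s t H S).
  have /subset_leq_card leVS : V \subset S.
    by apply/subsetP => y yV; rewrite -(joinsHV S clS x y).
  by apply: leq_trans leVS (leq_trans leSK _); rewrite ltnS subset_leq_card.
have eK : e \notin K.
  by apply/negP => /inS /andP[se te]; apply: neq; rewrite se te.
apply: (IH (s e |: (t e |: S)) (e |: K)).
- have := cardsD1 e (H :\: K); rewrite inE eK eH /= setDDl setUC; lia.
- by rewrite !inE xS !orbT.
- by rewrite subUset sub1set eH.
- move=> e' /setU1P [->|/inS /andP[se te]]; rewrite !inE ?eqxx ?orbT //.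
  by rewrite se te !orbT.
rewrite !cardsU1 eK.
have : ~~ ((s e \notin t e |: S) && (t e \notin S)).
  rewrite !inE; apply/negP => /andP[/norP[_ /negPf se] /negPf te].
  by apply: neq; rewrite se te.
by case: (s e \notin _); case: (t e \notin _) => //= _; lia.
Qed.

Lemma joins_card (T I : finType) (s t : I -> T) (H : {set I}) (V : {set T}) :
  joins s t H V -> #|V| <= #|H|.+1.
Proof.
move=> joinsHV; have [->|[x xV]] := set_0Vmem V; first by rewrite cards0.
apply: (joins_card_grow (K := set0) (S := [set x]) joinsHV xV).
- by rewrite inE.
- exact: sub0set.
- by move=> e; rewrite in_set0.
by rewrite cards1.
Qed.

(** What makes [D] cyclic: the ends of each edge of [D] stay connected through
    the rest of [D]. *)
Definition bypassed (T I : finType) (s t : I -> T) (D : {set I}) : Prop :=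
  forall e S, e \in D -> closed_under s t (D :\ e) S -> closed_under s t D S.

(** Triangular independence of cycles: the edge picked on a cycle [c] may
    otherwise only belong to cycles of higher rank. By induction on the rank,
    the ends of the edge removed from [c] are still connected: they are
    through the rest of [c], from which only edges picked on cycles of lower
    rank may be missing. *)
Lemma joins_cycles (T I J : finType) (s t : I -> T) (E : {set I}) (V : {set T})
    (C : {set J}) (D : J -> {set I}) (rank : J -> nat) :
    joins s t E V ->
    (forall c, c \in C -> D c \subset E) ->
    (forall c, c \in C -> bypassed s t (D c)) ->
    (forall c, c \in C -> exists2 e, e \in D c &
       forall c', c' \in C -> c' != c -> e \in D c' -> rank c < rank c') ->
  #|C| + #|V| <= #|E|.+1.
Proof.
move=> joinsEV sDE byp ex.
have [->|[c0 c0C]] := set_0Vmem C; first by rewrite cards0 (joins_card joinsEV).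
have /choice [pick pickP] (c : J) : exists e, c \in C -> e \in D c /\
    forall c', c' \in C -> c' != c -> e \in D c' -> rank c < rank c'.
  have [e0 _ _] := ex c0 c0C.
  case: (boolP (c \in C)) => [cC | _]; last by exists e0.
  by have [e eD eP] := ex c cC; exists e.
have pick_inj : {in C &, injective pick}.
  move=> c c' cC c'C eqp; apply: contraTeq isT => ne_cc'.
  have [eD eP] := pickP c cC; have [eD' eP'] := pickP c' c'C.
  have := eP c' c'C; rewrite eq_sym eqp => /(_ ne_cc' eD') lt.
  have := eP' c cC; rewrite -eqp => /(_ ne_cc' eD).
  by rewrite ltnNge ltnW.
have sPE : pick @: C \subset E.
  apply/subsetP => _ /imsetP[c cC ->].
  by apply: (subsetP (sDE c cC)); case: (pickP c cC).
suff /joins_card : joins s t (E :\: pick @: C) V.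
  by rewrite cardsDS // card_in_imset //; have := subset_leq_card sPE;
    rewrite card_in_imset //; lia.
move=> S clS; apply: joinsEV.
have clD c : c \in C -> closed_under s t (D c) S.
  have [k] := ubnP (rank c); elim: k => // k IH in c * => lt_ck cC.
  have [eD eP] := pickP c cC.
  apply: (byp c cC (pick c)) => // e /setD1P[ne eDc].
  have eE := subsetP (sDE c cC) e eDc.
  have [/imsetP[c' c'C eE']|nP] := boolP (e \in pick @: C); last first.
    by apply: clS; rewrite inE nP.
  have ne_c : c != c' by apply: contraNneq ne => ->; rewrite eE'.
  have [eD' eP'] := pickP c' c'C.
  apply: (IH c') => //; last by rewrite eE'.
  have lt: rank c' < rank c by apply: eP' => //; rewrite -eE'.
  exact: leq_trans lt _.
move=> e eE; have [/imsetP[c cC ->]|nP] := boolP (e \in pick @: C).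
  by apply: (clD c cC); case: (pickP c cC).
by apply: clS; rewrite inE nP.
Qed.

(** * The cycles of a Rauzy graph *)

(** The prefix and the suffix of length [n - 1] of [e]; reading them on the
    infinite repetition of [e] spares casts between tuple types. *)
Definition source (A : Type) (a : A) n (e : n.-tuple A) : (n - 1).-tuple A :=
  window (n - 1) (cyclic a e) 0.
Definition target (A : Type) (a : A) n (e : n.-tuple A) : (n - 1).-tuple A :=
  window (n - 1) (cyclic a e) 1.

Lemma cyclic_window_small (A : Type) (a : A) n P r i :
  i < n -> cyclic a (window n P r) i = P (r + i).
Proof. by move=> lt_in; rewrite /cyclic size_tuple modn_small ?nth_window. Qed.

Lemma source_window (A : Type) (a : A) n P r :
  source a (window n P r) = window (n - 1) P r.
Proof.
by apply/window_eq => i lt_i; rewrite cyclic_window_small ?add0n //; lia.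
Qed.

Lemma target_window (A : Type) (a : A) n P r :
  target a (window n P r) = window (n - 1) P r.+1.
Proof.
by apply/window_eq => i lt_i; rewrite cyclic_window_small ?addSnnS ?add1n //; lia.
Qed.

Lemma joins_factors (A : finType) (a : A) (w : nat -> A) n :
  joins (source a (n := n)) (target a (n := n))
    (Fac_len w n) (Fac_len w (n - 1)).
Proof.
move=> S clS; suff to0 i : (window (n - 1) w i \in S) = (window (n - 1) w 0 \in S).
  by move=> x y /FacP[i ->] /FacP[j ->]; rewrite !to0.
elim: i => // i <-.
have /clS : window n w i \in Fac_len w n by apply/FacP; exists i.
by rewrite source_window target_window.
Qed.

(** The windows of a periodic word form a closed walk. Starting at the end of
    the edge [e] and following the word until [e] comes back for the first
    time, one reaches the origin of [e] without using [e]. *)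
Lemma bypassed_windows (A : finType) (a : A) m n (P : nat -> A)
    (D : {set n.-tuple A}) :
    0 < m -> periodic m P -> (forall e, e \in D <-> exists r, e = window n P r) ->
  bypassed (source a (n := n)) (target a (n := n)) D.
Proof.
move=> m0 perm DP e S eD clS e' e'D.
have [->|ne] := eqVneq e' e; last by apply: clS; rewrite !inE ne.
move/DP: (eD) => [r eE].
have ex_return : exists j, window n P (r + j.+1) == e.
  exists m.-1; rewrite prednK // eE; apply/eqP/window_eq => i _.
  by rewrite addnAC perm.
have [j /eqP retj minj] := ex_minnP ex_return.
have walk k : k <= j ->
    (window (n - 1) P r.+1 \in S) = (window (n - 1) P (r.+1 + k) \in S).
  elim: k => [|k IH] lt_kj; first by rewrite addn0.
  rewrite (IH (ltnW lt_kj)) addnS -(source_window a) -(target_window a).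
  apply: clS; rewrite !inE; apply/andP; split; last by apply/DP; exists (r.+1 + k).
  by apply/negP; rewrite addSnnS => /minj; rewrite leqNgt lt_kj.
rewrite [in RHS]eE target_window (walk j) // addSnnS -(source_window a) retj.
by [].
Qed.

(** The cycle of a conjugacy class [c] of words of length [m >= n]. Prefixes are
    enough: rotating a word brings each window of its infinite repetition to
    the front. *)
Definition edges_of (A : finType) (a : A) m n (c : {set m.-tuple A}) :
    {set n.-tuple A} :=
  [set window n (cyclic a (v : m.-tuple A)) 0 | v in c].

Lemma edges_of_conj_class (A : finType) (a : A) m n (x : m.-tuple A)
    (e : n.-tuple A) :
  0 < m ->
  e \in edges_of a n (conj_class x) <->
  exists r, e = window n (cyclic a x) r.
Proof.
move=> m0; have cw r i := cyclic_window a r i m0 (cyclic_periodic a x).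
split=> [/imsetP[v /(conj_classP a _ _ m0)[r ->] ->]|[r ->]]; last first.
  apply/imsetP; exists (window m (cyclic a x) r).
    by apply/conj_classP => //; exists r.
  by apply/window_eq => i _; rewrite cw add0n.
by exists r; apply/window_eq => i _; rewrite cw add0n.
Qed.

Lemma window_Fac (A : finType) (a : A) (w : nat -> A) m n (x : m.-tuple A) r :
  0 < m -> n <= m -> conj_class x \subset Fac_len w m ->
  window n (cyclic a x) r \in Fac_len w n.
Proof.
move=> m0 le_nm /subsetP/(_ (window m (cyclic a x) r)).
case/(_ _)/FacP => [|i /window_eq eqw]; first by apply/conj_classP => //; exists r.
by apply/FacP; exists i; apply/window_eq => j lt_j; apply: eqw; apply: leq_trans le_nm.
Qed.

(** The classes of length [n + k] whose cycles are used: all of them when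
    [k = 0], otherwise those of the proper powers that do not have cyclic
    period [k]. The exclusion is uniform in [k] because for [j < k <= 2] the
    difference [k - j] divides [k], so that a periodic word with both periods
    [n + j] and [n + k] has period [k]. *)
Definition kept (A : finType) (w : nat -> A) (n k : nat) :
    {set {set (n + k).-tuple A}} :=
  [set conj_class u | u : (n + k).-tuple A
     & (conj_class u \subset Fac_len w (n + k)) &&
       `[< k = 0 \/ repetitive (n + k) (cyclic (w 0) u)
                    /\ ~ periodic k (cyclic (w 0) u) >]].

Lemma repetitive_shift_eq (A : Type) m (P Q : nat -> A) r s :
  0 < m -> periodic m P -> (forall i, P (r + i) = Q (s + i)) ->
  repetitive m Q -> repetitive m P.
Proof.
move=> m0 perm eqPQ [d [dm ltdm perd]]; exists d; split=> //.
exact: (periodic_shift_eq m0 perm perd eqPQ).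
Qed.

(** Rank 0 goes to the cycles of proper powers, which are pairwise disjoint,
    and rank 1 to those of the primitive classes of length [n], which have an
    edge on no other cycle and so may meet the others. *)
Lemma card_kept (A : finType) (w : nat -> A) n :
  6 <= n ->
  \sum_(k < 3) #|kept w n k| + #|Fac_len w (n - 1)| <= #|Fac_len w n|.+1.
Proof.
move=> n6; pose a := w 0.
pose J : finType := {k : 'I_3 & {set (n + k).-tuple A}}.
pose class (k : 'I_3) (c : {set (n + k).-tuple A}) : J :=
  @Tagged 'I_3 k (fun k : 'I_3 => {set (n + k).-tuple A}) c.
pose C := [set c : J | tagged c \in kept w n (tag c)].
have <- : #|C| = \sum_(k < 3) #|kept w n k|.
  rewrite -sum1_card.
  under [RHS]eq_bigr => k _ do rewrite -sum1_card.
  by rewrite sig_big_dep; apply: eq_bigl => c; rewrite inE.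
pose D (c : J) := edges_of a n (tagged c).
pose primitiveC (c : J) := exists2 v : (n + tag c).-tuple A, v \in tagged c &
  ~ repetitive (n + tag c) (cyclic a v).
pose rank c : nat := `[< primitiveC c >].
have n4 : 4 <= n by exact: leq_trans n6.
have pos (k : 'I_3) : 0 < n + k by lia.
have inb (k : 'I_3) : n <= n + k <= n + 2 by have := ltn_ord k; lia.
have CP c : c \in C -> exists (k : 'I_3) (x : (n + k).-tuple A),
    [/\ c = class k (conj_class x),
        conj_class x \subset Fac_len w (n + k) &
        k = 0 :> nat \/
        repetitive (n + k) (cyclic a x) /\ ~ periodic k (cyclic a x)].
  rewrite inE; case: c => k c /= /imsetP[x].
  by rewrite inE => /andP[sub /asboolP H] ->; exists k, x.
have rankP (k : 'I_3) (x : (n + k).-tuple A) :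
    rank (class k (conj_class x)) =
    ~~ `[< repetitive (n + k) (cyclic a x) >].
  congr nat_of_bool; rewrite -asbool_neg; apply: asbool_equiv_eq.
  split=> [[v /=]|nrep].
    move=> /(conj_classP a _ _ (pos k))[r ->] nrep rep; apply: nrep.
    apply: (repetitive_shift_eq (r := 0) (s := r) (pos k) _ _ rep).
      exact: cyclic_periodic.
    move=> i; rewrite add0n; apply: cyclic_window (pos k) _.
    exact: cyclic_periodic.
  exists x => //=; apply/(conj_classP a _ _ (pos k)); exists 0.
  by rewrite window_cyclic.
have DP (k : 'I_3) (x : (n + k).-tuple A) e :
    e \in D (class k (conj_class x)) <->
    exists r, e = window n (cyclic a x) r.
  exact: edges_of_conj_class.
apply: (joins_cycles (D := D) (rank := rank) (@joins_factors A a w n)).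
- move=> c /CP[k [x [-> sub _]]]; apply/subsetP => e /DP[r ->].
  by apply: window_Fac sub => //; rewrite leq_addr.
- move=> c /CP[k [x [-> _ _]]].
  exact: (@bypassed_windows A a _ n _ _ (pos k) (cyclic_periodic a x) (DP k x)).
have same (k : 'I_3) (x y : (n + k).-tuple A) r s :
    (forall i, cyclic a x (r + i) = cyclic a y (s + i)) ->
    class k (conj_class x) = class k (conj_class y).
  by move=> eqxy; congr class; apply: conj_class_eq (pos k) eqxy.
(* Two proper powers that share an edge have the same infinite repetition, up
   to a shift. If their lengths differ, both are periods of it, and the longer
   of the two words is one of those that kept excludes. *)
have disj (k l : 'I_3) (x : (n + k).-tuple A) (y : (n + l).-tuple A) r s :
    repetitive (n + k) (cyclic a x) -> repetitive (n + l) (cyclic a y) ->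
    l = 0 :> nat \/ ~ periodic l (cyclic a y) ->
    window n (cyclic a x) r = window n (cyclic a y) s ->
    l <= k.
  move=> repx repy nper /window_eq eqw; rewrite leqNgt; apply/negP => lt_kl.
  have l3 := ltn_ord l.
  case: nper => [|nper]; first lia.
  apply: nper.
  have eqxy := repetitive_agree n4 (inb k) (inb l) repx repy eqw.
  have peryx : periodic (n + k) (cyclic a y).
    apply: (periodic_shift_eq (r := s) (s := r) (pos l)
      (cyclic_periodic a y) (cyclic_periodic a x)).
    by move=> i; rewrite eqxy.
  apply: periodic_dvd (periodic_gcd peryx (cyclic_periodic a y)).
  have -> : n + l = (l - k) + (n + k) by lia.
  rewrite gcdnDr; apply: (dvdn_trans (dvdn_gcdr _ _)).
  have : l - k = 1 \/ (l - k = 2 /\ l = 2 :> nat) by lia.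
  by case=> [->|[-> ->]]; rewrite ?dvd1n.
move=> c /CP[k [x [-> _ Hx]]]; rewrite rankP.
have [repx|nrepx] := pselect (repetitive (n + k) (cyclic a x)); last first.
  have k0 : k = 0 :> nat by case: Hx => // -[/nrepx].
  have [r priv] : exists r, forall m (Q : nat -> A) s, n < m <= n + 2 ->
      repetitive m Q -> window n (cyclic a x) r <> window n Q s.
    move: (cyclic a x) (cyclic_periodic a x) nrepx => P.
    by rewrite k0 addn0; apply: private_window.
  exists (window n (cyclic a x) r); first by apply/DP; exists r.
  move=> c' /CP[l [y [-> _ Hy]]] ne /DP[s eqw]; exfalso.
  have l3 := ltn_ord l.
  have [l0|l0] := posnP l; last first.
    case: Hy => [l_0|[repy _]]; first by rewrite l_0 in l0.
    by apply: (priv _ _ s _ repy eqw); lia.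
  have eqlk : l = k by apply: val_inj; rewrite /= l0 k0.
  subst l; move/eqP: ne; apply; apply: (same _ _ _ s r).
  move=> i; rewrite -(periodic_mod (cyclic_periodic a x)).
  rewrite -(periodic_mod (cyclic_periodic a y)).
  (* The edge is as long as the common period n, so it fixes the class. *)
  symmetry; move/window_eq: eqw; apply.
  by have := ltn_pmod i (pos k); rewrite {2}k0 addn0.
(* Any edge will do for a proper power: it lies on no other cycle of rank 0. *)
exists (window n (cyclic a x) 0); first by apply/DP; exists 0.
move=> c' /CP[l [y [-> _ Hy]]] ne /DP[s eqw]; rewrite rankP.
rewrite asboolT //=; case: asboolP => // repy; exfalso.
have Nx : k = 0 :> nat \/ ~ periodic k (cyclic a x).
  by case: Hx => [|[]]; [left|right].
have Ny : l = 0 :> nat \/ ~ periodic l (cyclic a y).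
  by case: Hy => [|[]]; [left|right].
have eqlk : l = k.
  apply/val_inj/anti_leq/andP; split.
    exact: disj repx repy Ny eqw.
  exact: disj repy repx Nx (esym eqw).
subst l; move/eqP: ne; apply; apply: (same _ _ _ s 0) => i; symmetry.
by move/window_eq: eqw => /(repetitive_agree n4 (inb k) (inb k) repx repy).
Qed.

(** * Non-primitive classes *)

Lemma nth_word_pow (A : Type) (a : A) (v : seq A) k i :
  i < k * size v -> nth a (word_pow v k) i = nth a v (i %% size v).
Proof.
elim: k i => [|k IH] i; first by rewrite mul0n.
rewrite /word_pow /= nth_cat mulSn => lt_i.
case: ltnP => [lt_iv|ge_iv]; first by rewrite modn_small.
rewrite IH; last by lia.
by rewrite -[in RHS](subnK ge_iv) modnDr.
Qed.

Lemma size_word_pow (A : Type) (v : seq A) k : size (word_pow v k) = k * size v.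
Proof. by elim: k => //= k IH; rewrite size_cat [size (flatten _)]IH mulSn. Qed.

Lemma repetitive_nonprimitive (A : Type) (a : A) m (x : m.-tuple A) :
  0 < m -> ~ primitive x -> repetitive m (cyclic a x).
Proof.
move=> m0 /contrapT [v [k [ne xE]]].
have mE : m = k * size v by rewrite -size_word_pow -xE size_tuple.
have dvd_vm : size v %| m by rewrite mE dvdn_mull.
exists (size v); split=> //.
  rewrite ltn_neqAle dvdn_leq // andbT; apply/eqP => vE; apply: ne.
  have k1 : k = 1 by nia.
  by rewrite xE k1 /word_pow /= cats0.
move=> i; rewrite /cyclic size_tuple xE !nth_word_pow -?mE ?ltn_pmod //.
by rewrite !modn_dvdm // modnDr.
Qed.

(** A class that is neither primitive nor in [kept w n k] has cyclic period
    [k], and is determined by [k] letters of [w]. *)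
Lemma lie_complexity_le (A : finType) (w : nat -> A) n k :
  0 < n -> 0 < k ->
  lie_complexity w (n + k) <=
  primitive_lie_complexity w (n + k) + #|kept w n k| + #|Alph w| ^ k.
Proof.
move=> n0 k0; have m0 : 0 < n + k by rewrite addn_gt0 n0.
pose word (f : {ffun 'I_k -> A}) : (n + k).-tuple A :=
  window (n + k) (fun i => f (Ordinal (ltn_pmod i k0))) 0.
pose low := [set conj_class (word f) | f in ffun_on (mem (Alph w))].
have low_le : #|low| <= #|Alph w| ^ k.
  by rewrite (leq_trans (leq_imset_card _ _)) // card_ffun_on card_ord.
apply: leq_trans (_ : _ <= #|_ :|: kept w n k :|: low|) _; last first.
  apply: leq_trans (leq_card_setU _ _) (leq_add _ low_le).
  exact: leq_card_setU.
apply/subset_leq_card/subsetP => _ /imsetP[u /[!inE] sub ->].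
have [prim|/(repetitive_nonprimitive (w 0) m0) rep] := pselect (primitive u).
  by rewrite imset_f //= inE sub; apply/asboolP.
have [perk|nper] := pselect (periodic k (cyclic (w 0) u)); last first.
  apply/orP; left; apply/orP; right; apply: imset_f; rewrite inE sub.
  by apply/asboolP; right.
apply/orP; right; apply/imsetP.
exists [ffun i : 'I_k => cyclic (w 0) u i].
  apply/ffun_onP => i; rewrite ffunE inE; apply/asboolP.
  have /(subsetP sub) /FacP[j uE] : u \in conj_class u.
    by apply/(conj_classP (w 0)) => //; exists 0; rewrite window_cyclic.
  exists (j + i); rewrite uE cyclic_window_small //.
  by have := ltn_ord i; lia.
congr conj_class; rewrite -[LHS](window_cyclic (w 0)).
apply/window_eq => i _; rewrite ffunE /= !add0n.
by rewrite -[LHS](periodic_mod perk 0).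
Qed.

(** * The inequality *)

Import Order.TTheory GRing.Theory Num.Theory.
Local Open Scope ring_scope.

Theorem theorem4 (A : finType) (w : nat -> A) (n : nat) (hn : (6 <= n)%N) :
  (lie_complexity w n)%:Z + (lie_complexity w (n + 1))%:Z
    + (lie_complexity w (n + 2))%:Z
  <= (factor_complexity w n)%:Z - (factor_complexity w (n - 1))%:Z
     + 1 + 3 * #|Alph w|%:Z + #|Alph w|%:Z ^+ 2
     + (primitive_lie_complexity w (n + 1))%:Z
     + (primitive_lie_complexity w (n + 2))%:Z.
Proof.
have n0 : (0 < n)%N by lia.
have kept0 : #|kept w n 0| = lie_complexity w n.
  rewrite -[in RHS](addn0 n); apply: eq_card => c.
  apply/imsetP/imsetP => -[u]; rewrite inE => H ->; exists u => //.
    by rewrite inE; case/andP: H.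
  by rewrite inE H; apply/asboolP; left.
have cycles : (lie_complexity w n + #|kept w n 1| + #|kept w n 2|
    + factor_complexity w (n - 1) <= (factor_complexity w n).+1)%N.
  have := card_kept w hn.
  by rewrite !big_ord_recl big_ord0 addn0 addnA kept0.
have := lie_complexity_le w n0 (isT : 0 < 1)%N.
have := lie_complexity_le w n0 (isT : 0 < 2)%N.
by rewrite expn1 -mulnn expr2; nia.
Qed.
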